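(* For all integers $m\geq 1$ and $n\geq 1$, the coconut tree $CT(m,n)$ satisfies $F_d(CT(m,n))=n+\lceil\frac{m-1}{3}\rceil$.
   Context: The coconut tree $CT(m,n)$ is the graph obtained from the path $P_m$ on $m$ vertices by appending $n$ new pendant edges (each with a new leaf) at one end vertex of $P_m$. Zero forcing: given a set $B\subseteq V(G)$ of initially black vertices (all others white) of a finite simple graph $G$, at each step a black vertex having exactly one white neighbor forces that neighbor to become black; $B$ is a zero forcing set of $G$ if repeated application of this rule turns all vertices black. A set $D\subseteq V(G)$ is dominating if every vertex of $G$ is in $D$ or adjacent to a vertex of $D$. A dom-forcing set of $G$ is a set $D_f\subseteq V(G)$ that is both a dominating set of $G$ and a zero forcing set of $G$; the dom-forcing number $F_d(G)$ is the minimum cardinality of a dom-forcing set. *)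

(* Defs.v *)
From HB Require Import structures.
From mathcomp Require Import all_boot all_order all_algebra.

Set Implicit Arguments.
Unset Strict Implicit.
Unset Printing Implicit Defensive.

Record sgraph := SGraph {
  vertex :> finType;
  adj : rel vertex;
  adj_sym : symmetric adj;
  adj_irrefl : irreflexive adj
}.

Section DomForcing.
Variable G : sgraph.
Implicit Types B D : {set G}.

Definition white_neighbors B (u : G) : {set G} :=
  [set w | adj u w & w \notin B].

Definition force_step : rel {set G} := fun B B' =>
  [exists u in B, exists v,
     (white_neighbors B u == [set v]) && (B' == v |: B)].

Definition zero_forcing B : bool := connect force_step B [set: G].

Definition dominating D : bool :=
  [forall v : G, (v \in D) || [exists u in D, adj v u]].

Definition dom_forcing D : bool := dominating D && zero_forcing D.

Lemma dom_forcing_setT : dom_forcing [set: G].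
Proof.
by rewrite /dom_forcing /zero_forcing connect0 andbT; apply/forallP=> v; rewrite inE.
Qed.

(* The arg min is over all dom-forcing sets: by dom_forcing_setT the default
   [set: G] is one of them. *)
Definition dom_forcing_number : nat :=
  #|[arg min_(D < [set: G] | dom_forcing D) #|D| ]|.

Lemma dom_forcing_numberP :
  (exists2 D, dom_forcing D & #|D| = dom_forcing_number) /\
  (forall D, dom_forcing D -> dom_forcing_number <= #|D|).
Proof.
rewrite /dom_forcing_number; case: arg_minnP; first exact: dom_forcing_setT.
by move=> D dfD minD; split=> //; exists D.
Qed.

End DomForcing.

(* inl i are the vertices of the path P_m, joined when consecutive; inr k are
   the n new leaves, all attached to the end vertex 0 of the path.  The graph
   is CT(m,n) only for 0 < m: there is no end vertex when m = 0. *)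
Definition coconut_adj (m n : nat) : rel ('I_m + 'I_n) := fun x y =>
  match x, y with
  | inl i, inl j => (i.+1 == j :> nat) || (j.+1 == i :> nat)
  | inl i, inr _ => i == 0 :> nat
  | inr _, inl j => j == 0 :> nat
  | inr _, inr _ => false
  end.

Lemma coconut_adj_sym m n : symmetric (@coconut_adj m n).
Proof. by move=> [i|k] [j|l] //=; rewrite orbC. Qed.

Lemma coconut_adj_irrefl m n : irreflexive (@coconut_adj m n).
Proof. by move=> [i|k] //=; rewrite orbb; apply/eqP=> /esym/n_Sn. Qed.

Definition coconut_tree (m n : nat) : sgraph :=
  SGraph (@coconut_adj_sym m n) (@coconut_adj_irrefl m n).

(* Main.v *)
(** Dominating the far vertices [1 .. m-1] of the path costs [(m-1)/3] path
    vertices even if the leaves are free, as a vertex dominates at most three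
    others.  The leaves are pairwise twins, so a zero forcing set omits at most
    one of them; if it omits one, then the end vertex [0] must belong to it and
    cannot force first unless [1] also does.  A first force from elsewhere
    needs two adjacent path vertices or the far end of the path, and each of
    these wastes enough domination to pay for the omitted leaf. *)
Require Import Defs.
From HB Require Import structures.
From mathcomp Require Import all_boot all_order all_algebra.
From mathcomp Require Import zify lra.
Import Order.TTheory GRing.Theory Num.Theory.

Set Implicit Arguments.
Unset Strict Implicit.
Unset Printing Implicit Defensive.

(** * Zero forcing in an arbitrary graph *)

(** A vertex adjacent to one twin is adjacent to both, so while both are white neither is ever the
    unique white neighbor of anything. *)
Lemma zero_forcing_twins (G : sgraph) (B : {set G}) (a b : G) :
    a != b -> (forall u, adj u a = adj u b) -> zero_forcing B ->
  (a \in B) || (b \in B).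
Proof.
move=> neq_ab twin_ab /connectP[p].
elim: p B => [|B' p IHp] B /=; first by move=> _ <-; rewrite inE.
case/andP=> /exists_inP[u _ /existsP[v /andP[/eqP white_u /eqP defB']]] pathp.
move=> /(IHp _ pathp); rewrite {}defB' !inE.
have white w : (w == v) = adj u w && (w \notin B) by rewrite -in_set1 -white_u inE.
case: (boolP (a \in B)) => //= aNB; case: (boolP (b \in B)) => //= bNB.
rewrite !orbF => ab_v.
have: (a == v) && (b == v).
  by move: ab_v; rewrite !white twin_ab aNB bNB orbb !andbT => ->.
by case/andP=> /eqP av /eqP bv; rewrite av bv eqxx in neq_ab.
Qed.

Lemma zero_forcing_first_force (G : sgraph) (B : {set G}) :
    zero_forcing B -> B != [set: G] ->
  exists2 u, u \in B & exists v, white_neighbors B u = [set v].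
Proof.
case/connectP=> [[|B' p]] /=; first by move=> _ <-; rewrite eqxx.
case/andP=> /exists_inP[u Bu /existsP[v /andP[/eqP white_u _]]] _ _ _.
by exists u => //; exists v.
Qed.

(** Allowing [v] to be black already, with an empty forcing sequence, spares later constructions a
    case split. *)
Lemma force_closure (G : sgraph) (B : {set G}) (u v : G) :
    u \in B -> adj u v -> (forall w, adj u w -> w != v -> w \in B) ->
  connect (@force_step G) B (v |: B).
Proof.
move=> Bu adj_uv othersB; have [Bv | BNv] := boolP (v \in B).
  by rewrite (setUidPr _) ?sub1set.
apply/connect1/exists_inP; exists u => //; apply/existsP; exists v.
rewrite eqxx andbT; apply/eqP/setP=> w; rewrite !inE.
have [->|neq_wv] := eqVneq w v; first by rewrite adj_uv BNv.
by apply/negbTE/negP=> /andP[/othersB->].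
Qed.

Lemma size_dominated (S Q : seq nat) :
    uniq S -> (forall j, j \in S -> exists2 i, i \in Q & i <= j.+1 /\ j <= i.+1) ->
  size S <= 3 * size Q.
Proof.
move=> uniqS domS.
(* The element [i] accounts for [i.-1], [i] and [i.+1]; truncation at [i = 0] only repeats a
   value. *)
rewrite mulnC -(size_allpairs (fun i k => (i + k).-1) Q (iota 0 3)).
apply: uniq_leq_size => // j /domS[i Qi [ij ji]]; apply/allpairsP.
by exists (i, j.+1 - i); rewrite mem_iota /=; split=> //; lia.
Qed.

(** * Lower bound for the coconut tree *)

Section Coconut.
Variables m n : nat.
Implicit Type D : {set coconut_tree m n}.

Let pathv (i : 'I_m) : coconut_tree m n := inl i.
Let leaf (k : 'I_n) : coconut_tree m n := inr k.

(** Natural numbers rather than ordinals, so that counting may include positions beyond the path,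
    such as [m]. *)
Definition path_part D : seq nat := [seq val i | i : 'I_m in [pred i | pathv i \in D]].

Lemma path_part_uniq D : uniq (path_part D).
Proof. by rewrite map_inj_uniq ?enum_uniq //; apply: val_inj. Qed.

Lemma mem_path_part D (i : 'I_m) : (val i \in path_part D) = (pathv i \in D).
Proof. by rewrite mem_map ?mem_enum //; apply: val_inj. Qed.

Lemma card_coconut D : #|D| = size (path_part D) + #|[pred k | leaf k \in D]|.
Proof. by rewrite /path_part size_map -cardE -!sum1_card big_sumType. Qed.

(** Position 0 is excluded because a leaf can dominate it. *)
Lemma path_part_dominates D j :
    dominating D -> 0 < j < m ->
  exists2 i, i \in path_part D & i <= j.+1 /\ j <= i.+1.
Proof.
move=> /forallP domD /andP[j_gt0 ltjm].
have /orP[Dj | /exists_inP[[i|k] Di]] := domD (pathv (Ordinal ltjm)).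
- by exists j; [move: Dj; rewrite -mem_path_part | lia].
- by move=> /= adj_ji; exists i; [rewrite mem_path_part | lia].
- by move=> /=; rewrite eqn0Ngt j_gt0.
Qed.

Lemma size_path_part_all_leaves D :
  dominating D -> m.-1 <= 3 * size (path_part D).
Proof.
move=> domD; rewrite -(size_iota 1 m.-1); apply: size_dominated.
  exact: iota_uniq.
by move=> j; rewrite mem_iota => j_m; apply: path_part_dominates => //; lia.
Qed.

Lemma size_path_part_white_leaf D k :
    dom_forcing D -> 0 < m -> leaf k \notin D ->
  m.+2 <= 3 * size (path_part D).
Proof.
case/andP=> domD forceD m_gt0 DNk; set P := path_part D.
have P0 : 0 \in P.
  have /forallP/(_ (leaf k)) := domD.
  rewrite (negbTE DNk) /= => /exists_inP[[i|l] //= Di /eqP i0].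
  by rewrite -i0 mem_path_part.
have uniqP := path_part_uniq D.
have domP j := @path_part_dominates D j domD.
pose Q : seq nat := rem 0 P.
have memQ (i : nat) : (i \in Q) = (i != 0) && (i \in P) by rewrite mem_rem_uniq // inE.
have sizeP : size P = (size Q).+1 by rewrite size_rem // prednK; case: (P) P0.
have [m1 | m_gt1] := leqP m 1; first by lia.
(* As [P] is [Q] together with 0, it suffices that [Q] dominates [m.-1] distinct positions. *)
have bound (S : seq nat) : uniq S ->
  (forall j : nat, j \in S -> exists2 i, i \in Q & i <= j.+1 /\ j <= i.+1) ->
  m.-1 <= size S -> m.+2 <= 3 * size P.
  move=> uniqS domS mS; have := leq_trans mS (size_dominated uniqS domS).
  by rewrite sizeP mulnS; lia.
have domQ j : 1 < j < m -> exists2 i, i \in Q & i <= j.+1 /\ j <= i.+1.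
  move=> j_m; have [|i Pi ij] := domP j; first lia.
  by exists i; rewrite ?memQ ?Pi; lia.
(* Here 1 dominates itself, so [Q] covers the positions from 1 to [m.-1]. *)
have [P1 | PN1] := boolP (1 \in P).
  apply: (bound (iota 1 m.-1)); rewrite ?iota_uniq ?size_iota // => j.
  rewrite mem_iota => j_m; have [->|j1] := eqVneq j 1.
    by exists 1; rewrite ?memQ ?P1.
  by apply: domQ; lia.
(* The far end also covers the fictitious position [m], which replaces position 1 in the count. *)
have [Pm | PNm] := boolP (m.-1 \in P).
  apply: (bound (iota 2 m.-1)); rewrite ?iota_uniq ?size_iota // => j.
  rewrite mem_iota => j_m; have [->|jm] := eqVneq j m.
    by exists m.-1; rewrite ?memQ ?Pm; lia.
  by apply: domQ; lia.
(* The first forcing vertex is no leaf, since 0 is black, and is not 0, which has the white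
   neighbors [leaf k] and 1. It is thus interior to the path, and one of its two neighbors is
   black. *)
have [i [i_gt0 Pi Pi1]] : exists i, [/\ 0 < i, i \in P & i.+1 \in P].
  have [|u Du [v white_u]] := zero_forcing_first_force forceD.
    by apply: contraNneq DNk => ->; rewrite inE.
  have white w w' : adj u w -> adj u w' -> w \notin D -> w' \notin D -> w = w'.
    move=> uw uw' Dw Dw'.
    have: w \in [set v] by rewrite -white_u inE uw.
    have: w' \in [set v] by rewrite -white_u inE uw'.
    by rewrite !inE => /eqP-> /eqP->.
  have memD j (ltjm : j < m) : pathv (Ordinal ltjm) \in D = (j \in P).
    by rewrite -mem_path_part.
  case: u Du white_u white => [i|l] Du white_u white; last first.
    have: v \in white_neighbors D (leaf l) by rewrite white_u inE.
    rewrite inE; case: v {white_u} => [i|//] /andP[/eqP i0].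
    by rewrite -mem_path_part /= i0 (P0 : 0 \in path_part D).
  have Pi : val i \in P by rewrite mem_path_part.
  have [i0 | i_gt0] := posnP i.
    have := white (leaf k) (pathv (Ordinal m_gt1)).
    by rewrite /= memD i0 PN1 DNk /= => /(_ isT isT isT isT).
  have lti1m : i.+1 < m.
    have := ltn_ord i; rewrite leq_eqVlt => /orP[/eqP im | //].
    by rewrite -im /= Pi in PNm.
  have lti1m' : i.-1 < m by lia.
  have := white (pathv (Ordinal lti1m)) (pathv (Ordinal lti1m')).
  rewrite /= !memD => no_two_white.
  have [Pi1 | PNi1] := boolP (i.+1 \in P); first by exists i.
  have [Pi_1 | PNi_1] := boolP (i.-1 \in P).
    exists i.-1; rewrite prednK //; split=> //.
    have : i != 1 :> nat by apply: contraNneq PN1 => <-.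
    lia.
  have /(congr1 (fun x => if x is inl y then val y else 0)) /= :
    pathv (Ordinal lti1m) = pathv (Ordinal lti1m').
    by apply: no_two_white => //; lia.
  lia.
have uQ : uniq Q by rewrite rem_uniq.
have Qi1 : i.+1 \in Q by rewrite memQ Pi1.
have sizeQ : size Q = (size (rem i.+1 Q)).+1.
  by rewrite size_rem // prednK; case: (Q) Qi1.
(* Once [i.+1] is removed, [i] still covers [i] and [i.+1], so at most [i.+2] is lost. *)
have: size (filter (predC1 i.+2) (iota 2 m.-2)) <= 3 * size (rem i.+1 Q).
  apply: size_dominated; first by rewrite filter_uniq ?iota_uniq.
  move=> j; rewrite mem_filter mem_iota /= => /andP[j_i2 j_m].
  have [|q Qq qj] := domQ j; first lia.
  have [q_i1 | q_i1] := eqVneq q i.+1.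
    by exists i; [rewrite mem_rem_uniq // inE memQ Pi; lia | lia].
  by exists q; rewrite // mem_rem_uniq // inE q_i1.
rewrite -(rem_filter _ (iota_uniq _ _)).
have [/size_rem->|/rem_id->] := boolP (i.+2 \in iota 2 m.-2); rewrite size_iota; lia.
Qed.
(** An omitted leaf raises the path bound from [m.-1] to [m.+2], hence by exactly one vertex after
    division by 3. *)
Lemma card_dom_forcing_ge D :
  dom_forcing D -> 0 < m -> n + m.+1 %/ 3 <= #|D|.
Proof.
move=> dfD m_gt0; have [domD forceD] := andP dfD; rewrite card_coconut.
have [all_leaves | /forallPn[k DNk]] := boolP [forall k, leaf k \in D].
  have -> : #|[pred k | leaf k \in D]| = n.
    by rewrite -[RHS]card_ord; apply: eq_card => k; rewrite !inE (forallP all_leaves).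
  have := size_path_part_all_leaves domD; lia.
have : #|predC1 k| <= #|[pred k | leaf k \in D]|.
  apply/subset_leq_card/subsetP=> l /=; rewrite !inE => neq_lk.
  have := @zero_forcing_twins _ D (leaf l) (leaf k) neq_lk.
  by rewrite (negbTE DNk) orbF; apply=> // -[].
rewrite cardC1 card_ord.
have := size_path_part_white_leaf dfD m_gt0 DNk; lia.
Qed.

(** * A dom-forcing set attaining the bound *)

(** A leaf forces 0, then each path vertex forces the next one. *)
Lemma leaves_zero_forcing D :
  0 < n -> (forall k, leaf k \in D) -> zero_forcing D.
Proof.
move=> n_gt0 leavesD.
have forced j : j <= m -> exists B : {set coconut_tree m n},
    [/\ connect (@force_step _) D B, forall k, leaf k \in B
      & forall i : 'I_m, i < j -> pathv i \in B].
  elim: j => [|j IHj] ltjm; first by exists D; split=> //; apply: connect0.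
  have [B [DB leavesB pathB]] := IHj (ltnW ltjm).
  exists (pathv (Ordinal ltjm) |: B); split=> [|k|i]; last first.
  - rewrite ltnS leq_eqVlt => /orP[/eqP ij | /pathB Bi]; last first.
      by rewrite inE Bi orbT.
    by rewrite inE (@ord_inj _ i (Ordinal ltjm) ij) inE eqxx.
  - by rewrite inE leavesB orbT.
  apply: connect_trans DB _.
  case: j ltjm {IHj} pathB => [|j] ltjm pathB.
    apply: (@force_closure _ _ (leaf (Ordinal n_gt0))) => // -[i /eqP i0|k //].
    by rewrite (@ord_inj _ i (Ordinal ltjm) i0) eqxx.
  apply: (@force_closure _ _ (pathv (Ordinal (ltnW ltjm)))) => [||[i|k] //=].
  - exact: pathB.
  - by rewrite /= eqxx.
  case/orP=> [/eqP ij | /eqP ij _]; last by apply: pathB; lia.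
  by rewrite (@ord_inj _ i (Ordinal ltjm) (esym ij)) eqxx.
have [B [DB leavesB pathB]] := forced m (leqnn m).
rewrite /zero_forcing; suff <- : B = [set: _] by [].
by apply/setP=> -[i|k]; rewrite inE ?leavesB ?pathB.
Qed.

Lemma card_dom_forcing_attained :
    0 < m -> 0 < n ->
  exists2 D : {set coconut_tree m n}, dom_forcing D & #|D| <= n + m.+1 %/ 3.
Proof.
move=> m_gt0 n_gt0.
(* Centers of the blocks [3i+1, 3i+2, 3i+3]; the last center may equal [m] and is then moved back
   onto the path. Position 0 is left to the leaves. *)
pose s := [seq minn (3 * i + 2) m.-1 | i <- iota 0 (m.+1 %/ 3)].
pose D : {set coconut_tree m n} :=
  [set x : 'I_m + 'I_n | if x is inl i then val i \in s else true].
have leavesD k : leaf k \in D by rewrite inE.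
have pathD i : pathv i \in D = (val i \in s) by rewrite inE.
exists D.
  rewrite /dom_forcing (leaves_zero_forcing n_gt0) // andbT.
  apply/forallP=> -[i|k]; last by rewrite leavesD.
  have [i0 | i_gt0] := posnP i.
    by apply/orP/or_intror/exists_inP; exists (leaf (Ordinal n_gt0)) => //=; apply/eqP.
  pose q := minn (3 * (i.-1 %/ 3) + 2) m.-1.
  have ltim := ltn_ord i.
  have ltqm : q < m by lia.
  have Dq : pathv (Ordinal ltqm) \in D.
    by rewrite pathD; apply: map_f; rewrite mem_iota; lia.
  have [iq | iq] := eqVneq (i : nat) q.
    by rewrite (@ord_inj _ i (Ordinal ltqm) iq) Dq.
  apply/orP/or_intror/exists_inP; exists (pathv (Ordinal ltqm)) => //=.
  lia.
rewrite card_coconut addnC leq_add //; first by rewrite -[leqRHS]card_ord max_card.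
have <- : size s = m.+1 %/ 3 by rewrite size_map size_iota.
apply: uniq_leq_size; first exact: path_part_uniq.
by move=> _ /mapP[i + ->]; rewrite mem_enum inE pathD.
Qed.

Lemma dom_forcing_number_coconut :
  0 < m -> 0 < n -> dom_forcing_number (coconut_tree m n) = n + m.+1 %/ 3.
Proof.
move=> m_gt0 n_gt0; have [[D dfD cardD] minD] := dom_forcing_numberP (coconut_tree m n).
have [D' dfD' cardD'] := card_dom_forcing_attained m_gt0 n_gt0.
apply/eqP; rewrite eqn_leq (leq_trans (minD _ dfD') cardD') -cardD.
exact: card_dom_forcing_ge.
Qed.

End Coconut.

(** * From integer division to the ceiling *)

Local Open Scope ring_scope.

Lemma ceil_third (m : nat) :
  (0 < m)%N -> Num.ceil ((m%:R - 1) / 3%:R : rat) = (m.+1 %/ 3)%N%:Z.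
Proof.
move=> m_gt0; apply/eqP; rewrite ceil_eq.
have [q [r [r3 mE]]] : exists q r : nat, (r < 3)%N /\ m.+1 = (3 * q + r)%N.
  by exists (m.+1 %/ 3)%N, (m.+1 %% 3)%N; lia.
have -> : (m.+1 %/ 3)%N = q by lia.
(* So [(m - 1) / 3 = q + (r - 2) / 3], where the last term lies in []-1, 0]]. *)
have -> : m%:R - 1 = (3 * q)%:R + r%:R - 2%:R :> rat.
  by rewrite -natrD -mE -natr1; lra.
have r_le2 : r%:R <= 2%:R :> rat by rewrite ler_nat; lia.
have r_ge0 : 0 <= r%:R :> rat by rewrite ler0n.
rewrite intrD natrM; apply/andP; split; lra.
Qed.

Theorem theorem2p13 (m n : nat) (hm : (1 <= m)%N) (hn : (1 <= n)%N) :
  (dom_forcing_number (coconut_tree m n))%:Z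
    = n%:Z + Num.ceil ((m%:R - 1) / 3%:R : rat).
Proof. by rewrite dom_forcing_number_coconut // ceil_third // PoszD. Qed.
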